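(* Let $\gamma\in\mathfrak h_{\mathbb R}^*$ be dominant and let $J\subseteq P(\gamma)$. Let $u$ be the minimal length coset representative of $w_0W_\gamma\in W/W_\gamma$, where $w_0$ is the longest element of $W$ and $W_\gamma$ is the stabilizer of $\gamma$ in $W$. Define the conjugation maps $$(\gamma,J)'=\bigl(-u\gamma,\,-u(P(\gamma)\setminus J)\bigr)\qquad\text{and}\qquad \mathcal F^{(\gamma,J)}\longrightarrow\mathcal F^{(\gamma,J)'},\quad w\longmapsto w'=wu^{-1}.$$ Then these maps are well defined involutions. That is: $-u\gamma$ is dominant and $-u(P(\gamma)\setminus J)\subseteq P(-u\gamma)$; $((\gamma,J)')'=(\gamma,J)$; $w'\in\mathcal F^{(\gamma,J)'}$ for every $w\in\mathcal F^{(\gamma,J)}$; and $(w')'=w$ for every $w\in\mathcal F^{(\gamma,J)}$, where the outer prime is the conjugation map attached to $(\gamma,J)'$. In particular $w\mapsto w'$ is a bijection $\mathcal F^{(\gamma,J)}\to\mathcal F^{(\gamma,J)'}$.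
   Context: Let $R$ be a reduced crystallographic root system spanning the real vector space $\mathfrak h_{\mathbb R}^*\cong\mathbb R^n$, with Weyl group $W$, $W$-invariant inner product $\langle\,,\rangle$, positive roots $R^+$ and negative roots $R^-=-R^+$. An element $\gamma\in\mathfrak h_{\mathbb R}^*$ is dominant if $\langle\gamma,\alpha\rangle\ge0$ for all $\alpha\in R^+$. For $w\in W$ let $R(w)=\{\alpha\in R^+\mid w\alpha\in R^-\}$. For dominant $\gamma$, $$Z(\gamma)=\{\alpha\in R^+\mid\langle\gamma,\alpha\rangle=0\},\qquad P(\gamma)=\{\alpha\in R^+\mid\langle\gamma,\alpha\rangle=1\},$$ and for $J\subseteq P(\gamma)$, $$\mathcal F^{(\gamma,J)}=\{w\in W\mid R(w)\cap Z(\gamma)=\emptyset,\ R(w)\cap P(\gamma)=J\}.$$ *)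

(* Defs.v *)
From HB Require Import structures.
From mathcomp Require Import all_boot all_order all_algebra.
From mathcomp Require Import sesquilinear finmap.
From mathcomp Require Import boolp classical_sets functions reals.

Set Implicit Arguments.
Unset Strict Implicit.
Unset Printing Implicit Defensive.

Import Order.TTheory GRing.Theory Num.Theory.
Local Open Scope classical_set_scope.
Local Open Scope ring_scope.

Section RootSystem.
Variables (K : realType) (V : vectType K) (dot : {dot V for (@idfun K)}).

Definition reflection (a : V) : 'End(V) :=
  linfun (fun v => v - (2 * dot v a / dot a a) *: a).

(* [linfun] is only meaningful on linear functions; this one is linear. *)
Lemma reflectionE (a v : V) :
  reflection a v = v - (2 * dot v a / dot a a) *: a.
Proof.
pose f (x : V) : V := x - (2 * dot x a / dot a a) *: a.
have lin_f : linear f.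
  move=> k x y; rewrite /f linearPl /= mulrDr mulrDl scalerDl scalerBr.
  by rewrite scalerA opprD addrACA !mulrA [2 * k]mulrC.
pose fM := GRing.isLinear.Build K V V *:%R f lin_f.
pose fL : {linear V -> V} := HB.pack f fM.
by rewrite /reflection (lfunE fL v).
Qed.

(* Reflections are the orthogonal ones for [dot], so that [dot] is
   automatically invariant under the Weyl group. *)
Record is_root_system (Phi : {fset V}) : Prop := IsRootSystem {
  root_span : <<enum_fset Phi>>%VS = fullv;
  root_neq0 : forall a, a \in Phi -> a != 0;
  root_refl : forall a b, a \in Phi -> b \in Phi -> reflection a b \in Phi;
  root_int : forall a b, a \in Phi -> b \in Phi ->
    2 * dot b a / dot a a \is a Num.int;
  root_reduced : forall a (c : K), a \in Phi -> c *: a \in Phi ->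
    c = 1 \/ c = -1
}.

Definition natcomb n (S : n.-tuple V) (c : 'I_n -> nat) : V :=
  \sum_(i < n) tnth S i *+ c i.

(* A choice of positive roots is given by its simple roots. *)
Record is_simple_system (Phi : {fset V}) n (S : n.-tuple V) : Prop :=
  IsSimpleSystem {
  simple_root : forall i, tnth S i \in Phi;
  simple_basis : basis_of fullv S;
  simple_comb : forall b, b \in Phi ->
    exists c : 'I_n -> nat, b = natcomb S c \/ b = - natcomb S c
}.

Definition reflection_product (s : seq V) : 'End(V) :=
  \big[@comp_lfun K V V V / \1%VF]_(a <- s) reflection a.

Definition weyl (Phi : {fset V}) : set 'End(V) :=
  [set w | exists2 s : seq V, {subset s <= Phi} & w = reflection_product s].

Definition weyl_stab (Phi : {fset V}) (gamma : V) : set 'End(V) :=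
  [set w | weyl Phi w /\ w gamma = gamma].

Variables (Phi : {fset V}) (n : nat) (S : n.-tuple V).

Definition posroots : set V :=
  [set b | b \in Phi /\ exists c : 'I_n -> nat, b = natcomb S c].

Definition negroots : set V := [set - a | a in posroots].

Definition dominant (gamma : V) : Prop :=
  forall a, posroots a -> 0 <= dot gamma a.

Definition inversions (w : 'End(V)) : set V :=
  [set a | posroots a /\ negroots (w a)].

Definition has_word (w : 'End(V)) (k : nat) : Prop :=
  exists2 s : seq V, {subset s <= S} & size s = k /\ w = reflection_product s.

(* The default value 0 is irrelevant: simple reflections generate [weyl]. *)
Definition length (w : 'End(V)) : nat :=
  xget 0%N [set k | has_word w k /\ forall j, has_word w j -> (k <= j)%N].

Definition longest : 'End(V) :=
  xget \1%VF [set w | weyl Phi w /\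
    forall v, weyl Phi v -> (length v <= length w)%N].

Definition longest_coset (gamma : V) : set 'End(V) :=
  [set (longest \o v)%VF | v in weyl_stab Phi gamma].

Definition min_coset_rep (gamma : V) : 'End(V) :=
  xget \1%VF [set u | longest_coset gamma u /\
    forall v, longest_coset gamma v -> (length u <= length v)%N].

Definition Zset (gamma : V) : set V :=
  [set a | posroots a /\ dot gamma a = 0].

Definition Pset (gamma : V) : set V :=
  [set a | posroots a /\ dot gamma a = 1].

Definition Fset (p : V * set V) : set 'End(V) :=
  [set w | [/\ weyl Phi w, inversions w `&` Zset p.1 = set0
             & inversions w `&` Pset p.1 = p.2]].

Definition conj_pair (p : V * set V) : V * set V :=
  (- min_coset_rep p.1 p.1,
   [set - min_coset_rep p.1 a | a in Pset p.1 `\` p.2]).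

Definition conj_elt (p : V * set V) (w : 'End(V)) : 'End(V) :=
  (w \o (min_coset_rep p.1)^-1)%VF.

End RootSystem.

(* Main.v *)
(* By the exchange condition, right multiplication by the reflection in a
   positive root that [w] makes negative shortens [w]. Hence [w0] makes every
   positive root negative, and the minimal representative [u] of [w0 W_gamma]
   keeps positive the positive roots orthogonal to [gamma]. The other positive
   roots become negative under [u], because [u gamma = w0 gamma] is
   antidominant. An element of the Weyl group is determined by its inversion
   set, so that [u^-1] is the minimal representative attached to [- u gamma];
   everything else follows from this. *)
Require Import Defs.
From mathcomp Require Import all_boot all_order all_algebra.
From mathcomp Require Import sesquilinear finmap ring.
From mathcomp Require Import boolp classical_sets functions reals.
Import Order.TTheory GRing.Theory Num.Theory.
Local Open Scope classical_set_scope.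
Local Open Scope ring_scope.

Set Implicit Arguments.
Unset Strict Implicit.
Unset Printing Implicit Defensive.

Section WeylGroup.
Variables (K : realType) (V : vectType K) (dot : {dot V for (@idfun K)}).
Implicit Types (a b c u v : V) (s t : seq V) (w : 'End(V)).

Local Notation r := (reflection dot).
Local Notation rp := (reflection_product dot).

(** * Reflections and their products as isometries *)

Lemma dotC u v : dot u v = dot v u.
Proof. by rewrite hermC expr0 mul1r. Qed.

(* [linearNl] and [linearNr] rewrite [dot] to its underlying bilinear form, on
   which lemmas about [dot] no longer match. *)
Lemma dotNl u v : dot (- u) v = - dot u v.
Proof. exact: linearNl. Qed.

Lemma dotNr u v : dot u (- v) = - dot u v.
Proof. exact: linearNr. Qed.

Lemma dot_gt0 a : a != 0 -> 0 < dot a a.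
Proof. exact: neq0_dnorm_gt0. Qed.

Lemma reflection0 v : r 0 v = v.
Proof. by rewrite reflectionE scaler0 subr0. Qed.

Lemma reflection_self a : r a a = - a.
Proof.
have [->|a0] := eqVneq a 0; first by rewrite reflection0 oppr0.
by rewrite reflectionE mulfK ?gt_eqF ?dot_gt0// scaler_nat mulr2n opprD addrA
  subrr sub0r.
Qed.

Lemma reflection_isometry a u v : dot (r a u) (r a v) = dot u v.
Proof.
have [->|a0] := eqVneq a 0; first by rewrite !reflection0.
have d0 : dot a a != 0 by rewrite gt_eqF ?dot_gt0.
rewrite !reflectionE !linearBl !linearBr !linearZl_LR !linearZr_LR /=.
rewrite (dotC a v); by field.
Qed.

Lemma reflectionK a : involutive (r a).
Proof.
move=> v.
by rewrite (reflectionE dot a v) linearB linearZ /= reflection_self scalerN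
  opprK reflectionE subrK.
Qed.

Lemma reflectionN a : r (- a) = r a.
Proof.
apply/lfunP => v; rewrite !reflectionE dotNr dotNr dotNl opprK.
by rewrite mulrN mulNr scalerN scaleNr opprK.
Qed.

Lemma reflection_conj w a : (forall u v, dot (w u) (w v) = dot u v) ->
  (w \o r a = r (w a) \o w)%VF.
Proof.
move=> iso_w; apply/lfunP => v.
by rewrite !lfunE /= !reflectionE linearB linearZ /= !iso_w.
Qed.

Lemma reflection_product_cons a s : rp (a :: s) = (r a \o rp s)%VF.
Proof. by rewrite /reflection_product big_cons. Qed.

Lemma reflection_product_nil : rp [::] = \1%VF.
Proof. by rewrite /reflection_product big_nil. Qed.

Lemma reflection_product_cat s t : rp (s ++ t) = (rp s \o rp t)%VF.
Proof.
elim: s => [|a s IHs] /=; first by rewrite reflection_product_nil comp_lfun1l.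
by rewrite !reflection_product_cons IHs comp_lfunA.
Qed.

Lemma reflection_product_seq1 a : rp [:: a] = r a.
Proof. by rewrite reflection_product_cons reflection_product_nil comp_lfun1r.
  Qed.

Lemma reflection_product_isometry s u v : dot (rp s u) (rp s v) = dot u v.
Proof.
elim: s => [|a s IHs]; first by rewrite reflection_product_nil !lfunE.
by rewrite reflection_product_cons !lfunE /= reflection_isometry.
Qed.

Lemma reflection_product_rev s : cancel (rp s) (rp (rev s)).
Proof.
elim: s => [|a s IHs] v; first by rewrite /rev /= reflection_product_nil !lfunE.
rewrite rev_cons -cats1 reflection_product_cat reflection_product_seq1.
by rewrite reflection_product_cons !lfunE /= reflectionK.
Qed.

Lemma reflection_product_lker0 s : lker (rp s) == 0%VS.
Proof. by apply/lker0P; exact: can_inj (@reflection_product_rev s). Qed.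

(** [^-1] is total on endomorphisms; here the kernel is trivial and the reversed word is a left
    inverse, so [^-1] is that word. *)
Lemma reflection_product_inv s : ((rp s)^-1)%VF = rp (rev s).
Proof.
have sK : (rp (rev s) \o rp s = \1)%VF.
  by apply/lfunP => v; rewrite !lfunE /= reflection_product_rev.
rewrite -[LHS]comp_lfun1l -sK -comp_lfunA lker0_compfV ?comp_lfun1r//.
exact: reflection_product_lker0.
Qed.

Section RootSystem.
Variables (Phi : {fset V}) (n : nat) (S : n.-tuple V).
Hypotheses (rootPhi : is_root_system dot Phi) (simpleS : is_simple_system Phi
  S).

Local Notation W := (weyl dot Phi).
Local Notation pos := (posroots Phi S).

(** * The Weyl group and its action on the roots *)

Lemma weyl1 : W \1%VF.
Proof. by exists [::] => //; rewrite reflection_product_nil. Qed.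

Lemma weylM w w' : W w -> W w' -> W (w \o w')%VF.
Proof.
move=> [s sP ->] [t tP ->]; exists (s ++ t);
  last by rewrite reflection_product_cat.
by move=> a; rewrite mem_cat => /orP[/sP|/tP].
Qed.

Lemma weyl_inv w : W w -> W (w^-1)%VF.
Proof.
move=> [s sP ->]; exists (rev s); last by rewrite reflection_product_inv.
by move=> a; rewrite mem_rev => /sP.
Qed.

Lemma weyl_reflection a : a \in Phi -> W (r a).
Proof.
move=> aP; exists [:: a]; last by rewrite reflection_product_seq1.
by move=> b; rewrite mem_seq1 => /eqP ->.
Qed.

Lemma weyl_lker0 w : W w -> lker w == 0%VS.
Proof. by move=> [s _ ->]; exact: reflection_product_lker0. Qed.

Lemma weylK w : W w -> cancel w (w^-1)%VF.
Proof. by move=> /weyl_lker0 /lker0_lfunK. Qed.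

Lemma weylVK w : W w -> cancel (w^-1)%VF w.
Proof.
by move=> /weyl_lker0 /lker0_compfV wV v; have /lfunP/(_ v) := wV;
  rewrite !lfunE.
Qed.

Lemma weyl_isometry w u v : W w -> dot (w u) (w v) = dot u v.
Proof. by move=> [s _ ->]; exact: reflection_product_isometry. Qed.

Lemma weyl_root w a : W w -> a \in Phi -> w a \in Phi.
Proof.
move=> [s + ->] aP; elim: s => [|b s IHs] sP;
  first by rewrite reflection_product_nil lfunE.
rewrite reflection_product_cons lfunE /=; apply: (root_refl rootPhi).
  by apply: sP; rewrite mem_head.
by apply: IHs => c cs; apply: sP; rewrite inE cs orbT.
Qed.

(** * Simple coordinates and positivity of roots *)

Lemma simple_mem a : a \in S -> exists i, a = tnth S i.
Proof. by move=> /tnthP[i ->]; exists i. Qed.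

Lemma coord_tnth i j : coord S i (tnth S j) = (j == i)%:R.
Proof. by rewrite (tnth_nth 0) coord_free// (basis_free (simple_basis
  simpleS)). Qed.

Lemma coord_natcomb (c : 'I_n -> nat) i : coord S i (natcomb S c) = (c i)%:R.
Proof.
rewrite /natcomb linear_sum (bigD1 i)//= big1 ?addr0 => [|j ji].
  by rewrite linearMn /= coord_tnth eqxx.
by rewrite linearMn /= coord_tnth (negPf ji) mul0rn.
Qed.

Lemma simple_coordE v : v = \sum_(i < n) coord S i v *: tnth S i.
Proof.
rewrite {1}(coord_basis (simple_basis simpleS) (memvf v)).
by apply: eq_bigr => i _; rewrite (tnth_nth 0).
Qed.

Lemma eq_coord u v : (forall i, coord S i u = coord S i v) -> u = v.
Proof.
move=> uv; rewrite [u]simple_coordE [v]simple_coordE.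
by apply: eq_bigr => i _; rewrite uv.
Qed.

Lemma pos_root b : pos b -> b \in Phi.
Proof. by case. Qed.

Lemma pos_coord_ge0 b i : pos b -> 0 <= coord S i b.
Proof. by move=> [_ [c ->]]; rewrite coord_natcomb. Qed.

Lemma pos_coord_gt0 b : pos b -> exists i, 0 < coord S i b.
Proof.
move=> bpos; apply: contrapT => /forallNP b0.
have /negP := root_neq0 rootPhi (pos_root bpos); apply; apply/eqP.
apply: eq_coord => i; rewrite linear0; apply/eqP;
  rewrite eq_le pos_coord_ge0// andbT.
by rewrite leNgt; apply/negP.
Qed.

Lemma pos_asym b : pos b -> ~ pos (- b).
Proof.
move=> /pos_coord_gt0[i bi] /(pos_coord_ge0 i).
by rewrite linearN /= oppr_ge0 leNgt bi.
Qed.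

Lemma rootN a : a \in Phi -> - a \in Phi.
Proof. by move=> aP; rewrite -reflection_self; exact: (root_refl rootPhi). Qed.

Lemma pos_total b : b \in Phi -> pos b \/ pos (- b).
Proof.
move=> bP; have [c [bc|bc]] := simple_comb simpleS bP.
  by left; split => //; exists c.
by right; split; [exact: rootN|exists c; rewrite bc opprK].
Qed.

Lemma negrootsE b : negroots Phi S b <-> pos (- b).
Proof.
split=> [[a apos <-]|bneg]; first by rewrite opprK.
by exists (- b) => //; rewrite opprK.
Qed.

Lemma simple_pos i : pos (tnth S i).
Proof.
split; first exact: simple_root simpleS i.
exists (fun j => (j == i) : nat); apply: eq_coord => j.
by rewrite coord_tnth coord_natcomb eq_sym.
Qed.

(* Only the [i]-th coordinate changes, and another one is positive. *)
Lemma simple_reflection_pos i b :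
  pos b -> b <> tnth S i -> pos (r (tnth S i) b).
Proof.
move=> bpos bi; have iP := simple_root simpleS i.
have [//|neg] := pos_total (root_refl rootPhi iP (pos_root bpos)).
exfalso; apply: bi.
have coordr j : j != i -> coord S j (r (tnth S i) b) = coord S j b.
  by move=> ji; rewrite reflectionE linearB linearZ /= coord_tnth [i ==
    j]eq_sym (negPf ji) mulr0 subr0.
have bj j : j != i -> coord S j b = 0.
  move=> ji; apply/eqP; rewrite eq_le pos_coord_ge0// andbT -coordr//.
  by rewrite -oppr_ge0 -linearN pos_coord_ge0.
have bE : b = coord S i b *: tnth S i.
  apply: eq_coord => j; rewrite linearZ /= coord_tnth.
  by have [<-|ij] := eqVneq i j; rewrite ?mulr1// mulr0 bj// eq_sym.
(* Reducedness leaves only the factors 1 and -1, and -1 is no coordinate of a positive root. *)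
have := pos_root bpos; rewrite bE => /(root_reduced rootPhi iP)[->|bN1].
  by rewrite scale1r.
by have := pos_coord_ge0 i bpos; rewrite bN1 oppr_ge0 ler10.
Qed.

(** * Generation by simple reflections *)

Lemma pos_simple_dot b : pos b -> exists i, 0 < dot b (tnth S i).
Proof.
move=> bpos; apply: contrapT => /forallNP b0.
(* Otherwise [dot b b], expanded along the simple roots in its second argument, would be at most
   0. *)
have := dot_gt0 (root_neq0 rootPhi (pos_root bpos)).
rewrite {2}[b]simple_coordE linear_sumr /= ltNge => /negP; apply.
apply: sumr_le0 => i _; rewrite linearZr_LR /=.
by rewrite mulr_ge0_le0 ?pos_coord_ge0// leNgt; apply/negP.
Qed.

Lemma simple_reflection_word i : exists2 s, {subset s <= S} & r (tnth S i) = rp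
  s.
Proof.
exists [:: tnth S i]; last by rewrite reflection_product_seq1.
by move=> a; rewrite mem_seq1 => /eqP ->; exact: mem_tnth.
Qed.

(* Induction on the height: the simple reflection of an [S i] with
   [dot b (S i) > 0] lowers the height of [b] and keeps it positive. *)
Lemma pos_reflection_word b :
  pos b -> exists2 s, {subset s <= S} & r b = rp s.
Proof.
(* [m] bounds the height, read off from the explicit coefficients [c]; at height 0 no coordinate
   could be positive. *)
suff H m b' (c : 'I_n -> nat) : pos b' -> b' = natcomb S c ->
    (\sum_(i < n) c i <= m)%N -> exists2 s, {subset s <= S} & r b' = rp s.
  by move=> bpos; have [_ [c bE]] := bpos; exact: (H _ b c bpos bE (leqnn _)).
elim: m b' c => [|m IHm] b' c bpos bE cm.
  have [i] := pos_coord_gt0 bpos; rewrite bE coord_natcomb ltr0n.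
  by move: cm; rewrite leqn0 sum_nat_eq0 => /forallP/(_ i)/eqP ->.
have [i bi] := pos_simple_dot bpos.
have [->|/eqP bNi] := eqVneq b' (tnth S i); first exact: simple_reflection_word.
have bpos' := simple_reflection_pos bpos bNi.
have [_ [c' bE']] := bpos'.
have c'E j : (c' j)%:R = (c j)%:R - 2 * dot b' (tnth S i)
    / dot (tnth S i) (tnth S i) * (i == j)%:R :> K.
  rewrite -!coord_natcomb -bE' -bE reflectionE linearB linearZ /=.
  by rewrite coord_tnth.
have c'j j : j != i -> c' j = c j.
  move=> ji; apply/eqP; rewrite -(eqr_nat K) c'E [i == j]eq_sym (negPf ji).
  by rewrite mulr0 subr0.
have c'i : (c' i < c i)%N.
  rewrite -(ltr_nat K) c'E eqxx mulr1 gtrBl divr_gt0 ?mulr_gt0//.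
  exact/dot_gt0/(root_neq0 rootPhi)/(simple_root simpleS).
have {IHm} [|s sS rs] := IHm _ c' bpos' bE'.
  rewrite -ltnS; apply: leq_trans cm.
  rewrite (bigD1 i)//= [ltnRHS](bigD1 i)//= -addSn leq_add//.
  by apply: leq_sum => j ji; rewrite c'j.
(* [r b'] is the conjugate by [r (tnth S i)] of the reflection in the lower root, which [s]
   spells. *)
exists (tnth S i :: rcons s (tnth S i)).
  by move=> a; rewrite inE mem_rcons inE => /or3P[/eqP->|/eqP->|/sS]//;
    exact: mem_tnth.
rewrite reflection_product_cons -cats1 reflection_product_cat.
rewrite reflection_product_seq1 -rs -reflection_conj;
  last exact: reflection_isometry.
by rewrite comp_lfunA; apply/lfunP => v; rewrite !lfunE /= lfunE /= reflectionK.
Qed.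

(** Ensures that [length] minimizes over a nonempty set. *)
Lemma weyl_has_word w : W w -> exists k, has_word dot S w k.
Proof.
move=> [s + ->]; elim: s => [|a s IHs] sP.
  by exists 0%N, [::] => //; rewrite reflection_product_nil.
have [|_ [t tS [_ tE]]] := IHs; first by move=> b bs; apply: sP;
  rewrite inE bs orbT.
have [t' t'S t'E] : exists2 s, {subset s <= S} & r a = rp s.
  have /pos_total[] : a \in Phi by apply: sP; rewrite mem_head.
    exact: pos_reflection_word.
  by rewrite -(reflectionN a); exact: pos_reflection_word.
exists (size (t' ++ t)), (t' ++ t).
  by move=> b; rewrite mem_cat => /orP[/t'S|/tS].
by rewrite reflection_product_cons reflection_product_cat tE t'E.
Qed.

(** * Exchange condition and length *)

Lemma word_weyl s : {subset s <= S} -> W (rp s).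
Proof.
move=> sS; exists s => // a /sS /simple_mem[i ->]; exact: simple_root simpleS i.
Qed.

(* The letter to drop is the one at which [b] becomes negative. *)
Lemma exchange s b : {subset s <= S} -> pos b -> pos (- rp s b) ->
  exists t, [/\ {subset t <= S}, (size t).+1 = size s & (rp s \o r b)%VF = rp
    t].
Proof.
move=> + bpos; elim: s => [_|a s IHs sS].
  by rewrite reflection_product_nil lfunE /= => /(pos_asym bpos).
have aS : a \in S by apply: sS; rewrite mem_head.
have {}sS : {subset s <= S} by move=> c cs; apply: sS; rewrite inE cs orbT.
rewrite reflection_product_cons lfunE /= -comp_lfunA.
have [sbpos neg|/(IHs sS)[t [tS <- ->]] _] :=
    pos_total (weyl_root (word_weyl sS) (pos_root bpos)); last first.
  exists (a :: t); split => //; last by rewrite reflection_product_cons.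
  by move=> c; rewrite inE => /orP[/eqP->//|/tS].
(* Conjugation turns [rp s \o r b] into [r (rp s b) \o rp s]. As [r a] makes no positive root but
   [a] negative, [rp s b = a] and the two reflections cancel. *)
exists s; split => //; rewrite reflection_conj;
  last exact: reflection_product_isometry.
have [i aE] := simple_mem aS.
have -> : rp s b = a.
  apply: contrapT => sba; apply: pos_asym neg; rewrite aE.
  by apply: simple_reflection_pos; rewrite -?aE.
by apply/lfunP => v; rewrite !lfunE /= lfunE /= reflectionK.
Qed.

Local Notation len := (length dot S).

Lemma length_word w : W w ->
  has_word dot S w (len w) /\ forall j, has_word dot S w j -> (len w <= j)%N.
Proof.
move=> wW; rewrite /length.
apply: (@xgetPex _ 0%N [set k | has_word dot S w k /\
  forall j, has_word dot S w j -> (k <= j)%N]).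
have [k wk] := weyl_has_word wW.
have exP : exists k, `[< has_word dot S w k >] by exists k; exact/asboolP.
case: (ex_minnP exP) => m /asboolP wm min_m; exists m; split => // j wj.
by apply: min_m; exact/asboolP.
Qed.

Lemma length_reflection_lt w b :
  W w -> pos b -> pos (- w b) -> (len (w \o r b)%VF < len w)%N.
Proof.
move=> wW bpos neg; have [[s sS [sw wE]] _] := length_word wW.
rewrite wE in neg; have [t [tS st tE]] := exchange sS bpos neg.
have wbW := weylM wW (weyl_reflection (pos_root bpos)).
have [_ /(_ (size t))] := length_word wbW.
rewrite -sw -st ltnS; apply; exists t => //; split => //.
by rewrite -tE -wE.
Qed.

(** If a shortest word of [w] ended in [a], with [s] before it, then [rp s a = - w a] would be
    negative, so [w] would be shorter than [rp s], whose length is at most [size s]. *)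
Lemma weyl_pos_id w : W w -> (forall b, pos b -> pos (w b)) -> w = \1%VF.
Proof.
move=> wW wpos; have [[s sS [sw wE]] _] := length_word wW.
case/lastP: s => [|s a] in sS sw wE; first by rewrite wE reflection_product_nil.
have /simple_mem[i aE] : a \in S by apply: sS; rewrite mem_rcons mem_head.
have {}sS : {subset s <= S} by move=> c cs; apply: sS;
  rewrite mem_rcons inE cs orbT.
have apos : pos a by rewrite aE; exact: simple_pos.
move: wE; rewrite -cats1 reflection_product_cat reflection_product_seq1 => wE.
have lens : (len (rp s) <= size s)%N.
  by have [_] := length_word (word_weyl sS); apply; exists s.
have := @length_reflection_lt (rp s) a (word_weyl sS) apos.
rewrite -wE -sw size_rcons ltnNge (leq_trans lens)// => H.
suff /H : pos (- rp s a) by [].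
rewrite -linearN -(reflection_self a).
by have := wpos a apos; rewrite wE lfunE.
Qed.

(** The agreement extends to negative roots by a change of sign, so [w \o w'^-1] preserves
    positivity and is the identity. *)
Lemma weyl_eq_pos w w' : W w -> W w' ->
  (forall b, pos b -> (pos (w b) <-> pos (w' b))) -> w = w'.
Proof.
move=> wW w'W ww'.
have posE b : b \in Phi -> pos (w b) <-> pos (w' b).
  move=> /[dup] bP /pos_total[/ww'//|bneg].
  have /pos_total wb := weyl_root wW bP.
  have /pos_total w'b := weyl_root w'W bP.
  have := ww' _ bneg; rewrite !linearN /= => -[H1 H2].
  by split=> [p|p]; [case: w'b => // /H2 /(pos_asym p)|case: wb => // /H1
    /(pos_asym p)].
have vW := weyl_inv w'W.
have /(congr1 (fun f => (f \o w')%VF)) : (w \o w'^-1)%VF = \1%VF.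
  apply: weyl_pos_id; first exact: weylM.
  move=> b bpos; rewrite lfunE /=; apply/posE;
    first exact: weyl_root vW (pos_root bpos).
  by rewrite weylVK.
by rewrite lker0_compfVK ?comp_lfun1l//; exact: weyl_lker0.
Qed.

(** * Finiteness of the group and its longest element *)

Lemma weyl_eq_root w w' : (forall a, a \in Phi -> w a = w' a) -> w = w'.
Proof.
move=> ww'; apply/lfunP => v; rewrite [v]simple_coordE !linear_sum.
by apply: eq_bigr => i _; rewrite !linearZ /= ww'//;
  exact: simple_root simpleS i.
Qed.

(* A Weyl group element is determined by the permutation of [Phi] it induces,
   so that the group is finite. *)
Lemma length_bounded : exists m, forall w, W w -> (len w <= m)%N.
Proof.
(* Elements of the group map [Phi] to itself, so the default of [insubd] is never reached for them.
   The default of [q] can only enlarge the maximum. *)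
pose p w : {ffun Phi -> Phi} := [ffun a => insubd a (w (val a))].
pose q f := xget \1%VF [set w | W w /\ p w = f].
exists (\max_(f : {ffun Phi -> Phi}) len (q f))%N => w wW.
have [qW pq] : W (q (p w)) /\ p (q (p w)) = p w.
  by apply: (@xgetPex _ \1%VF [set v | W v /\ p v = p w]); exists w.
suff {1}-> : w = q (p w) by exact: leq_bigmax.
apply: weyl_eq_root => a aP.
have := congr1 (fun f : {ffun Phi -> Phi} => val (f [` aP]%fset)) pq.
by rewrite !ffunE !val_insubd /= !weyl_root.
Qed.

Local Notation w0 := (longest dot Phi S).

Lemma longestP : W w0 /\ forall w, W w -> (len w <= len w0)%N.
Proof.
apply: (@xgetPex _ \1%VF [set w | W w /\ forall w', W w' -> (len w' <= len
  w)%N]).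
have [m mP] := length_bounded.
pose P k := `[< exists2 w, W w & len w = k >].
have exP : exists k, P k by exists (len \1%VF); apply/asboolP;
  exists \1%VF => //; exact: weyl1.
have ubP k : P k -> (k <= m)%N by move=> /asboolP[w wW <-]; exact: mP.
case: (ex_maxnP exP ubP) => k /asboolP[w wW <-] max_w; exists w;
  split => // v vW.
by apply: max_w; apply/asboolP; exists v.
Qed.

(** If [w0 b] were positive, [w0 \o r b] would make [b] negative, so multiplying it by [r b] again
    would give [w0] as a shorter element, against maximality. *)
Lemma longest_neg b : pos b -> pos (- w0 b).
Proof.
move=> bpos; have [w0W w0max] := longestP.
have rW := weyl_reflection (pos_root bpos).
have [p|//] := pos_total (weyl_root w0W (pos_root bpos)).
have := @length_reflection_lt _ b (weylM w0W rW) bpos.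
rewrite lfunE /= reflection_self linearN /= opprK => /(_ p).
have -> : ((w0 \o r b) \o r b)%VF = w0.
  by apply/lfunP => v; rewrite !lfunE /= lfunE /= reflectionK.
by rewrite ltnNge w0max//; exact: weylM.
Qed.

(** * The minimal representative [u] of the longest coset *)

Lemma min_coset_repP gamma (u := min_coset_rep dot Phi S gamma) :
  longest_coset dot Phi S gamma u /\
  forall w, longest_coset dot Phi S gamma w -> (len u <= len w)%N.
Proof.
apply: (@xgetPex _ \1%VF [set u | longest_coset dot Phi S gamma u /\
  forall w, longest_coset dot Phi S gamma w -> (len u <= len w)%N]).
pose P k := `[< exists2 w, longest_coset dot Phi S gamma w & len w = k >].
have exP : exists k, P k.
  exists (len (w0 \o \1)%VF); apply/asboolP; exists (w0 \o \1)%VF => //.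
  by exists \1%VF => //; split; [exact: weyl1|rewrite lfunE].
case: (ex_minnP exP) => k /asboolP[w wC <-] min_w; exists w; split => // v vC.
by apply: min_w; apply/asboolP; exists v.
Qed.

Section Dominant.
Variable gamma : V.
Hypothesis gamma_dom : dominant dot Phi S gamma.
Local Notation u := (min_coset_rep dot Phi S gamma).

Lemma min_coset_rep_weyl : W u.
Proof.
have [[v [vW _] <-] _] := min_coset_repP gamma.
by apply: weylM => //; have [] := longestP.
Qed.

(** Here [r b] fixes [gamma], so [u \o r b] lies in the coset of [u]; it would be shorter if [u b]
    were negative. *)
Lemma min_coset_rep_orth b : pos b -> dot gamma b = 0 -> pos (u b).
Proof.
move=> bpos gb; have uW := min_coset_rep_weyl; have bP := pos_root bpos.
have [//|neg] := pos_total (weyl_root uW bP).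
have := length_reflection_lt uW bpos neg.
have [[v [vW vg] vE] min_u] := min_coset_repP gamma.
rewrite ltnNge min_u//; exists (v \o r b)%VF; last by rewrite comp_lfunA vE.
split; first by apply: weylM => //; exact: weyl_reflection.
by rewrite lfunE /= [r b gamma]reflectionE gb mulr0 mul0r scale0r subr0.
Qed.

(* [u gamma = w0 gamma] is antidominant, so [u] cannot keep [b] positive. *)
Lemma min_coset_rep_neg b : pos b -> 0 < dot gamma b -> pos (- u b).
Proof.
move=> bpos gb; have uW := min_coset_rep_weyl; have bP := pos_root bpos.
have [p|//] := pos_total (weyl_root uW bP).
have [w0W _] := longestP; have w0'W := weyl_inv w0W.
have [[v [vW vg] vE] _] := min_coset_repP gamma.
have ug : u gamma = w0 gamma by rewrite -vE lfunE /= vg.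
move: gb; rewrite -(weyl_isometry gamma b uW) ug.
have -> : dot (w0 gamma) (u b) = dot gamma ((w0^-1)%VF (u b)).
  by rewrite -[in RHS](weyl_isometry _ _ w0W) weylVK.
(* [w0 c = u b] is positive, so [c] is negative and dominance gives [dot gamma c <= 0]; yet this
   number equals [dot gamma b]. *)
set c := (w0^-1)%VF (u b).
have [cpos|/gamma_dom] := pos_total (weyl_root w0'W (pos_root p)).
  by have := longest_neg cpos; rewrite weylVK// => /(pos_asym p).
by rewrite dotNr oppr_ge0 ltNge => ->.
Qed.

Lemma min_coset_rep_pos b : pos b -> (pos (u b) <-> dot gamma b = 0).
Proof.
move=> bpos; split; last exact: min_coset_rep_orth.
move=> ub; apply/eqP; rewrite eq_le gamma_dom// andbT leNgt.
by apply/negP => /(min_coset_rep_neg bpos) /(pos_asym ub).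
Qed.

(** * The conjugate weight [- u gamma] *)

Lemma conj_dot c : dot (- u gamma) (u c) = - dot gamma c.
Proof.
by rewrite dotNl weyl_isometry//; exact: min_coset_rep_weyl.
Qed.

(** The criterion of [min_coset_rep_pos] for the weight [- u gamma], with [u^-1] in the place of its
    representative; this is what identifies the two. *)
Lemma min_coset_rep_inv_pos b :
  pos b -> (pos ((u^-1)%VF b) <-> dot (- u gamma) b = 0).
Proof.
move=> bpos; have uW := min_coset_rep_weyl.
have bE : b = u ((u^-1)%VF b) by rewrite weylVK.
have /pos_total := weyl_root (weyl_inv uW) (pos_root bpos).
move: bE; set c := (u^-1)%VF b => bE ctot.
rewrite bE conj_dot; split=> [cpos|/eqP].
  by rewrite (min_coset_rep_pos cpos).1 ?oppr0 -?bE.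
rewrite oppr_eq0 => /eqP gc; case: ctot => // cneg.
have /(min_coset_rep_orth cneg) : dot gamma (- c) = 0 by rewrite dotNr gc oppr0.
by rewrite linearN /= -bE => /(pos_asym bpos).
Qed.

(** Write [b = u c]. The pairing is 0 if [c] is positive, and [dot gamma (- c)] if [c] is
    negative. *)
Lemma conj_dominant : dominant dot Phi S (- u gamma).
Proof.
move=> b bpos; have uW := min_coset_rep_weyl.
have bE : b = u ((u^-1)%VF b) by rewrite weylVK.
have /pos_total := weyl_root (weyl_inv uW) (pos_root bpos).
move: bE; set c := (u^-1)%VF b => bE [cpos|cneg].
  by rewrite (min_coset_rep_inv_pos bpos).1.
by rewrite bE conj_dot -dotNr gamma_dom.
Qed.

(** A root pairing to 1 with [gamma] is made negative by [u]. Conversely, [u^-1 b] is negative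
    because [b] is not orthogonal to [- u gamma]. *)
Lemma conj_Pset b :
  Pset dot Phi S (- u gamma) b <-> exists2 c, Pset dot Phi S gamma c & b = - u
    c.
Proof.
have uW := min_coset_rep_weyl; split=> [[bpos b1]|[c [cpos c1] ->]].
  exists (- (u^-1)%VF b); last by rewrite linearN /= opprK weylVK.
  split; last first.
    by rewrite dotNr -conj_dot weylVK.
  have [p|//] := pos_total (weyl_root (weyl_inv uW) (pos_root bpos)).
  by move: b1; rewrite (min_coset_rep_inv_pos bpos).1// => /eqP;
    rewrite eq_sym oner_eq0.
split; first by apply: min_coset_rep_neg => //; rewrite c1.
by rewrite dotNr conj_dot opprK.
Qed.

End Dominant.

Lemma min_coset_rep_conj gamma (u := min_coset_rep dot Phi S gamma) :
  dominant dot Phi S gamma -> min_coset_rep dot Phi S (- u gamma) = (u^-1)%VF.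
Proof.
move=> gamma_dom; have uW := min_coset_rep_weyl gamma.
apply: weyl_eq_pos; [exact: min_coset_rep_weyl|exact: weyl_inv|move=> b bpos].
rewrite min_coset_rep_pos//; last exact: conj_dominant.
by rewrite min_coset_rep_inv_pos.
Qed.

(** * The conjugation maps *)

Section Conjugation.
Variables (gamma : V) (J : set V).
Hypotheses (gamma_dom : dominant dot Phi S gamma).
Hypothesis JP : J `<=` Pset dot Phi S gamma.
Local Notation u := (min_coset_rep dot Phi S gamma).
Local Notation p := (gamma, J).
Local Notation p' := (conj_pair dot Phi S p).

Lemma conj_pair_sub : p'.2 `<=` Pset dot Phi S p'.1.
Proof. by move=> _ [c [cP _] <-]; apply/conj_Pset => //; exists c. Qed.

(** The second conjugation uses [u^-1], so the signs and [u] cancel; the double complement returns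
    [J] because [J] lies in [P(gamma)]. *)
Lemma conj_pairK : conj_pair dot Phi S p' = p.
Proof.
have uW := min_coset_rep_weyl gamma; have u_inj := can_inj (weylK uW).
rewrite {1}/conj_pair /= min_coset_rep_conj//; congr pair.
  by rewrite linearN /= opprK weylK.
apply/seteqP; split=> [_ [_ [/(conj_Pset gamma_dom)[c cP ->] cJ] <-]|c cJ].
  rewrite linearN /= opprK weylK//; apply: contrapT => cNJ; apply: cJ.
  by exists c.
exists (- u c); last by rewrite linearN /= opprK weylK.
split; first by apply/(conj_Pset gamma_dom); exists c => //; exact: JP.
by move=> [d [_ dNJ] /oppr_inj/u_inj dc]; apply: dNJ; rewrite dc.
Qed.

(** At the root [- u c] the new element takes the value [- w c]: this change of sign is why [J] is
    replaced by its complement. *)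
Lemma conj_elt_Fset w : Fset dot Phi S p w -> Fset dot Phi S p' (conj_elt dot
  Phi S p w).
Proof.
move=> [wW wZ /= wJ]; have uW := min_coset_rep_weyl gamma.
split; rewrite /conj_elt /=; first exact: weylM wW (weyl_inv uW).
- rewrite -subset0 => b [[bpos /negrootsE]] + [_ b0]; rewrite lfunE /=.
  (* Here [u^-1 b] is positive and orthogonal to [gamma], so it would be an inversion of [w] in
     [Z(gamma)]. *)
  have /(min_coset_rep_inv_pos gamma_dom bpos) cpos := b0 => cneg.
  suff : (inversions Phi S w `&` Zset dot Phi S gamma) ((u^-1)%VF b) by rewrite
    wZ.
  split; split => //; first exact/negrootsE.
  by apply/(min_coset_rep_pos gamma_dom cpos); rewrite weylVK.
- have negJ c : Pset dot Phi S gamma c -> (pos (w c) <-> ~ J c).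
    move=> cP; have cpos : pos c by case: cP.
    rewrite -wJ; split=> [wc [[_ /negrootsE/(pos_asym wc)]]//|cN].
    have [//|wcN] := pos_total (weyl_root wW (pos_root cpos)).
    by exfalso; apply: cN; split => //; split => //; exact/negrootsE.
  apply/seteqP; split=> [b [[bpos /negrootsE]]|_ [c [cP cNJ] <-]].
    rewrite lfunE /= => + /(conj_Pset gamma_dom)[c cP bE].
    rewrite bE linearN /= weylK// linearN /= opprK => wc.
    by exists c => //; split => //; apply/negJ.
  have cP' : Pset dot Phi S (- u gamma) (- u c) by apply/conj_Pset => //;
    exists c.
  split => //; split; first by case: cP'.
  by apply/negrootsE; rewrite lfunE /= linearN /= weylK// linearN /= opprK;
    apply/negJ.
Qed.

Lemma conj_eltK w : conj_elt dot Phi S p' (conj_elt dot Phi S p w) = w.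
Proof.
have uW := min_coset_rep_weyl gamma.
rewrite /conj_elt /= min_coset_rep_conj//.
by rewrite lker0_compfK //; exact: weyl_lker0 (weyl_inv uW).
Qed.

End Conjugation.

End RootSystem.

End WeylGroup.

Theorem theorem4p9 (K : realType) (V : vectType K)
    (dot : {dot V for (@idfun K)}) (Phi : {fset V}) (n : nat)
    (S : n.-tuple V) (gamma : V) (J : set V) :
  is_root_system dot Phi ->
  is_simple_system Phi S ->
  dominant dot Phi S gamma ->
  J `<=` Pset dot Phi S gamma ->
  let p := (gamma, J) in
  let p' := conj_pair dot Phi S p in
  [/\ dominant dot Phi S p'.1 /\ p'.2 `<=` Pset dot Phi S p'.1,
      conj_pair dot Phi S p' = p,
      forall w, Fset dot Phi S p w ->
        Fset dot Phi S p' (conj_elt dot Phi S p w),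
      forall w, Fset dot Phi S p w ->
        conj_elt dot Phi S p' (conj_elt dot Phi S p w) = w
    & set_bij (Fset dot Phi S p) (Fset dot Phi S p') (conj_elt dot Phi S p)].
Proof.
move=> rootPhi simpleS gamma_dom JP p p'.
have dom' : dominant dot Phi S p'.1 by exact: conj_dominant.
have sub' : p'.2 `<=` Pset dot Phi S p'.1 by exact: conj_pair_sub.
have p'K : conj_pair dot Phi S p' = p by exact: conj_pairK.
have eltK w : conj_elt dot Phi S p' (conj_elt dot Phi S p w) = w by exact:
  conj_eltK.
have maps w : Fset dot Phi S p w -> Fset dot Phi S p' (conj_elt dot Phi S p w).
  exact: conj_elt_Fset.
split => //; split=> [w /maps//|w v _ _ wv|w wF];
  first by rewrite -(eltK w) wv eltK.
(* For surjectivity, the lemmas are applied to [p'], whose conjugate is [p] by [p'K]. *)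
exists (conj_elt dot Phi S p' w).
  by rewrite -p'K; exact: (conj_elt_Fset rootPhi simpleS dom').
by rewrite -[in LHS]p'K; exact: (conj_eltK rootPhi simpleS p'.2 dom').
Qed.
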